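(* The composition of two single-mode Gaussian channels, first the one with parameters $(X_1,Y_1)$ and then the one with parameters $(X_2,Y_2)$, is again a Gaussian channel, with deterministic matrix $X_{21}=X_2X_1$ and noise matrix $Y_{21}=X_2Y_1X_2^T+Y_2$. Hence the following holds for a fiber modeled as a cascade of $L\ge1$ segments. Fix a frequency $\Omega\in\mathbb R$, a segment length $\delta z>0$, an acoustic linewidth $\Gamma>0$ and a temperature $T_m>0$. For $k=1,\dots,L$ let $\alpha_{s,k}\ge0$ be the optical attenuation coefficient, $\widetilde G_k\in\mathbb C$ the pump-enhanced opto-acoustic coupling and $\Omega_{B,k}>0$ the Brillouin frequency of segment $k$, and set $$\eta_k=e^{-\alpha_{s,k}\delta z},\quad \eta_k'=1-\eta_k,\quad \chi_k=\frac{1}{\Gamma/2+\mathrm i(\Omega-\Omega_{B,k})},\quad \kappa_k=|\widetilde G_k|^2\chi_k\,\delta z,$$ $$\mu_k=\sqrt{\eta_k}+\kappa_k,\quad \nu_k=-\mathrm i\,\widetilde G_k\sqrt{\Gamma}\,\chi_k\,\delta z,\quad n_{\mathrm{th},k}=\frac{1}{\exp\!\left(\frac{\hbar\Omega_{B,k}}{k_BT_m}\right)-1}.$$ Let $\mathcal E_k$ be the single-mode Gaussian channel of segment $k$, with parameters $$X_k=\begin{pmatrix}\operatorname{Re}\mu_k&-\operatorname{Im}\mu_k\\ \operatorname{Im}\mu_k&\operatorname{Re}\mu_k\end{pmatrix},\qquad Y_k=\left[\left(n_{\mathrm{th},k}+\tfrac12\right)|\nu_k|^2+\tfrac{\eta_k'}{2}\right]I_2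 .$$ Then the fiber channel $\mathcal E_{\mathrm{fiber}}=\mathcal E_L\circ\mathcal E_{L-1}\circ\cdots\circ\mathcal E_1$ is the Gaussian channel with parameters $$X_{\mathrm{tot}}=X_LX_{L-1}\cdots X_1,\qquad Y_{\mathrm{tot}}=\sum_{k=1}^L\left(X_LX_{L-1}\cdots X_{k+1}\right)Y_k\left(X_LX_{L-1}\cdots X_{k+1}\right)^T,$$ and explicitly $$X_{\mathrm{tot}}=\begin{pmatrix}\operatorname{Re}\mu_{\mathrm{tot}}&-\operatorname{Im}\mu_{\mathrm{tot}}\\ \operatorname{Im}\mu_{\mathrm{tot}}&\operatorname{Re}\mu_{\mathrm{tot}}\end{pmatrix},\qquad Y_{\mathrm{tot}}=y_{\mathrm{tot}}I_2,$$ with $$\mu_{\mathrm{tot}}=\prod_{k=1}^L\mu_k,\qquad y_{\mathrm{tot}}=\sum_{k=1}^L\left(\prod_{j=k+1}^L|\mu_j|^2\right)\left[\tfrac{\eta_k'}{2}+\left(n_{\mathrm{th},k}+\tfrac12\right)|\nu_k|^2\right].$$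
   Context: A single-mode Gaussian channel is a quantum channel on one bosonic mode that maps Gaussian states to Gaussian states; it has parameters $(X,Y)$, with $X,Y$ real $2\times2$ matrices and $Y$ symmetric, if it acts on the mean vector $d\in\mathbb R^2$ and covariance matrix $V\in\mathbb R^{2\times2}$ of the mode's quadratures by $d\mapsto Xd$, $V\mapsto XVX^T+Y$. Here $q=(a+a^\dagger)/\sqrt2$, $p=(a-a^\dagger)/(\mathrm i\sqrt2)$, $R=(q,p)^T$, $d=\langle R\rangle$ and $V_{jk}=\tfrac12\langle\{R_j-d_j,R_k-d_k\}\rangle$, so the vacuum has $V=\tfrac12I_2$. The channel $\mathcal E_k$ describes the action of the $k$-th short fiber segment on the Stokes (probe) mode under the linearized stimulated Brillouin scattering interaction: $a_{\mathrm{out}}=\mu_k a_{\mathrm{in}}+\sqrt{\eta_k'}\,v_k+\nu_k b_k^\dagger$, with $v_k$ a vacuum optical bath mode and $b_k$ a phonon mode in the thermal state of mean occupation $n_{\mathrm{th},k}$. Empty matrix products equal $I_2$ (the $2\times2$ identity matrix) and empty scalar products equal $1$; $\hbar,k_B>0$ are the physical constants. *)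

(* Defs.v *)
From HB Require Import structures.
From mathcomp Require Export all_boot all_order all_algebra.
From mathcomp Require Export complex.
From mathcomp Require Export all_classical all_reals all_analysis.

Set Implicit Arguments.
Unset Strict Implicit.
Unset Printing Implicit Defensive.

Import Order.TTheory GRing.Theory Num.Theory.
Import numFieldNormedType.Exports.

Local Open Scope classical_set_scope.
Local Open Scope ring_scope.
Local Open Scope complex_scope.

(** The Hilbert space of one bosonic mode is represented by its Fock basis
    [|0>, |1>, |2>, ...]: an operator [A] is the infinite matrix of its elements
    [A m n = <m|A|n>].  This covers bounded operators as well as the unbounded
    polynomials in the ladder operators. *)
Definition op (R : realType) := nat -> nat -> R[i].

(** Sum of a complex series; it is a junk value when the series diverges, and is
    only used below where convergence is guaranteed by the context. *)
Definition csum (R : realType) (u : nat -> R[i]) : R[i] :=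
  limn (series (fun n => complex.Re (u n)))
  +i* limn (series (fun n => complex.Im (u n))).

Definition opadd (R : realType) (A B : op R) : op R := fun m n => A m n + B m n.
Definition opscale (R : realType) (c : R[i]) (A : op R) : op R :=
  fun m n => c * A m n.
Definition opid (R : realType) : op R := fun m n => (m == n)%:R.
Definition opmul (R : realType) (A B : op R) : op R :=
  fun m n => csum (fun k => A m k * B k n).
Definition opadj (R : realType) (A : op R) : op R := fun m n => (A n m)^*.
Definition optr (R : realType) (A : op R) : R[i] := csum (fun n => A n n).

(** [0 <= z] in [R[i]] means that [z] is real and nonnegative, so positivity
    includes hermiticity. *)
Definition positive_op (R : realType) (A : op R) : Prop :=
  forall (N : nat) (v : nat -> R[i]),
    0 <= \sum_(k < N) \sum_(l < N) (v k)^* * A k l * v l.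

(** Positivity of the operator [sum_(i,j) |i><j| (x) T i j] on [C^n (x) H]. *)
Definition positive_block (R : realType) (n : nat) (T : 'I_n -> 'I_n -> op R) :
    Prop :=
  forall (N : nat) (v : 'I_n -> nat -> R[i]),
    0 <= \sum_(i < n) \sum_(j < n) \sum_(k < N) \sum_(l < N)
           (v i k)^* * T i j k l * v j l.

(** A positive matrix with summable diagonal is a positive trace-class operator;
    general trace-class operators are the linear combinations of these. *)
Definition positive_trace_class (R : realType) (A : op R) : Prop :=
  positive_op A /\ cvgn (series (fun n => complex.Re (A n n))).

Definition trace_class (R : realType) (T : op R) : Prop :=
  exists P1 P2 P3 P4 : op R,
    [/\ positive_trace_class P1, positive_trace_class P2,
        positive_trace_class P3, positive_trace_class P4 &
        forall m n, T m n = P1 m n - P2 m n + (0 +i* 1) * (P3 m n - P4 m n)].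

Definition state (R : realType) (rho : op R) : Prop :=
  positive_trace_class rho /\ optr rho = 1.

Definition annihilation (R : realType) : op R :=
  fun m n => if n == m.+1 then (Num.sqrt n%:R)%:C else 0.
Definition creation (R : realType) : op R := opadj (annihilation R).

Definition position_op (R : realType) : op R :=
  opscale (Num.sqrt 2)^-1%:C (opadd (annihilation R) (creation R)).
Definition momentum_op (R : realType) : op R :=
  opscale ((0 +i* 1) * (Num.sqrt 2)%:C)^-1
    (opadd (annihilation R) (opscale (-1) (creation R))).

Definition quadrature (R : realType) (j : 'I_2) : op R :=
  if j == 0 then position_op R else momentum_op R.

Definition expectation (R : realType) (rho A : op R) : R[i] :=
  optr (opmul rho A).

(** Finite mean photon number; as [q^2 + p^2 = 2 a^* a + 1], this is finiteness of
    the second moments of both quadratures. *)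
Definition finite_second_moments (R : realType) (rho : op R) : Prop :=
  cvgn (series (fun n => n%:R * complex.Re (rho n n))).

Definition state_mean (R : realType) (rho : op R) : 'cV[R]_2 :=
  \col_j complex.Re (expectation rho (quadrature R j)).

Definition centered_quadrature (R : realType) (rho : op R) (j : 'I_2) : op R :=
  opadd (quadrature R j) (opscale (- (state_mean rho j 0)%:C) (opid R)).

Definition state_covariance (R : realType) (rho : op R) : 'M[R]_2 :=
  \matrix_(j, k)
    let A := centered_quadrature rho j in
    let B := centered_quadrature rho k in
    complex.Re (expectation rho (opadd (opmul A B) (opmul B A))) / 2.

(** Fock matrix elements of the displacement operator
      [exp (alpha a^* - conj(alpha) a)
        = exp (- |alpha|^2 / 2) exp (alpha a^* ) exp (- conj(alpha) a)]. *)
Definition displacement (R : realType) (alpha : R[i]) : op R := fun m n =>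
  (expR (- (Normc.normc alpha) ^+ 2 / 2))%:C *
  \sum_(k < (minn m n).+1)
     (Num.sqrt ((m`! * n`!)%N%:R) / (k`! * (m - k)`! * (n - k)`!)%N%:R)%:C
     * alpha ^+ (m - k) * (- alpha^*) ^+ (n - k).

(** [exp (i (xi_0 q + xi_1 p))] is the displacement operator with amplitude
    [(- xi_1 + i xi_0) / sqrt 2]. *)
Definition weyl (R : realType) (xi : 'cV[R]_2) : op R :=
  displacement ((- xi 1 0 / Num.sqrt 2) +i* (xi 0 0 / Num.sqrt 2)).

Definition characteristic_function (R : realType) (rho : op R)
    (xi : 'cV[R]_2) : R[i] :=
  expectation rho (weyl xi).

(** The characteristic function is [exp (i xi^T d - xi^T V xi / 2)]. *)
Definition gaussian_state (R : realType) (rho : op R) : Prop :=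
  state rho /\
  exists (d : 'cV[R]_2) (V : 'M[R]_2), V^T = V /\
    forall xi : 'cV[R]_2,
      let phase := (xi^T *m d) 0 0 in
      characteristic_function rho xi =
        (expR (- (xi^T *m V *m xi) 0 0 / 2))%:C * (cos phase +i* sin phase).

(** Completely positive trace-preserving linear maps on the trace-class operators;
    the values of [Phi] elsewhere are irrelevant. *)
Record quantum_channel (R : realType) (Phi : op R -> op R) : Prop := {
  channel_trace_class : forall T, trace_class T -> trace_class (Phi T);
  channel_linear : forall (c : R[i]) (S T : op R),
    trace_class S -> trace_class T ->
    Phi (opadd (opscale c S) T) = opadd (opscale c (Phi S)) (Phi T);
  channel_completely_positive : forall (n : nat) (T : 'I_n -> 'I_n -> op R),
    (forall i j, trace_class (T i j)) ->
    positive_block T -> positive_block (fun i j => Phi (T i j));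
  channel_trace_preserving : forall T, trace_class T -> optr (Phi T) = optr T
}.

(** The moments are transformed as prescribed for every state for which they
    exist, Gaussian or not. *)
Record gaussian_channel (R : realType) (X Y : 'M[R]_2) (Phi : op R -> op R) :
    Prop := {
  gaussian_channel_channel : quantum_channel Phi;
  gaussian_channel_gaussian :
    forall rho, gaussian_state rho -> gaussian_state (Phi rho);
  gaussian_channel_noise_sym : Y^T = Y;
  gaussian_channel_moments : forall rho,
    state rho -> finite_second_moments rho ->
    [/\ finite_second_moments (Phi rho),
        state_mean (Phi rho) = X *m state_mean rho &
        state_covariance (Phi rho) = X *m state_covariance rho *m X^T + Y]
}.

(** The real 2 x 2 matrix of multiplication by [z] on [C = R^2]. *)
Definition complex_mx (R : realType) (z : R[i]) : 'M[R]_2 :=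
  \matrix_(i, j) if i == j then complex.Re z
                 else if i == 0 then - complex.Im z else complex.Im z.

(** [X_n X_(n-1) ... X_(m+1)], the later factors standing on the left; it is the
    identity when [n <= m]. *)
Definition descending_prod (R : realType) (X : nat -> 'M[R]_2) (m n : nat) :
    'M[R]_2 :=
  \prod_(j <- rev (index_iota m.+1 n.+1)) X j.

(** [E_L o E_(L-1) o ... o E_1]. *)
Fixpoint cascade (R : realType) (E : nat -> op R -> op R) (L : nat) :
    op R -> op R :=
  if L is n.+1 then E n.+1 \o cascade E n else id.

(* Main.v *)
(** The moment assumption on the second channel only concerns states, so the
    composition law needs the output of the first channel to be a state.
    Complete positivity (with a single block) makes it a positive operator; as it
    is trace class, its diagonal is a real linear combination of diagonals of
    positive trace-class operators, hence summable.  The cascade follows by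
    induction, and the closed form from [complex_mx] being multiplicative with
    [complex_mx z *m (complex_mx z)^T = |z|^2 I]. *)

Require Import Defs.
From mathcomp Require Import ring.
Set Implicit Arguments.
Unset Strict Implicit.
Unset Printing Implicit Defensive.
Import Order.TTheory GRing.Theory Num.Theory.
Import numFieldNormedType.Exports.
Local Open Scope ring_scope.
Local Open Scope complex_scope.

(** Complete positivity is phrased for block operators; the 1 x 1 block is what lets it act on
    [positive_op]. *)
Lemma positive_op_block (R : realType) (A : op R) :
  positive_op A <-> positive_block (fun _ _ : 'I_1 => A).
Proof.
split=> [posA N v | posA N v]; first by rewrite !big_ord1; exact: posA.
by have := posA N (fun=> v); rewrite !big_ord1.
Qed.

Lemma positive_op_diag (R : realType) (A : op R) (n : nat) :
  positive_op A -> 0 <= A n n.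
Proof.
(* Test against the basis vector |n>, cut at length n + 1 so that the only surviving term is the
   last one of both sums. *)
move=> /(_ n.+1 (fun k => (k == n)%:R)).
rewrite big_ord_recr /= big1 ?add0r => [|k _].
  rewrite big_ord_recr /= big1 ?add0r => [|l _].
    by rewrite eqxx mulr1n rmorph1 mul1r mulr1.
  by rewrite (ltn_eqF (ltn_ord l)) mulr0.
by rewrite big1 // => l _; rewrite (ltn_eqF (ltn_ord k)) mulr0n rmorph0 !mul0r.
Qed.

Lemma positive_op_diag_Im (R : realType) (A : op R) (n : nat) :
  positive_op A -> complex.Im (A n n) = 0.
Proof. by move=> /(positive_op_diag n); case: (A n n) => x y /andP[/eqP]. Qed.

(** The zero operator pads the four-term decomposition in [trace_class]. *)
Lemma positive_trace_class0 (R : realType) :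
  positive_trace_class (fun _ _ => 0 : R[i]).
Proof.
split=> [N v|].
  by rewrite big1 // => k _; rewrite big1 // => l _; rewrite mulr0 mul0r.
have -> : series (fun=> 0) = cst (0 : R).
  by apply/funext => n; rewrite /series /= big1.
exact: is_cvg_cst.
Qed.

Lemma positive_trace_class_trace_class (R : realType) (A : op R) :
  positive_trace_class A -> trace_class A.
Proof.
move=> Atc; pose Z : op R := fun _ _ => 0.
have Z0 := positive_trace_class0 R.
by exists A, Z, Z, Z; split=> // m n; rewrite !subr0 mulr0 addr0.
Qed.

(* Positive operators have a real diagonal, so the two imaginary summands of a
   trace-class decomposition do not contribute to the real part. *)
Lemma trace_class_positive (R : realType) (A : op R) :
  trace_class A -> positive_op A -> positive_trace_class A.
Proof.
move=> [P1 [P2 [P3 [P4 [[_ c1] [_ c2] [p3 _] [p4 _] AE]]]]] posA; split=> //.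
have -> : (fun n => complex.Re (A n n)) =
    (fun n => complex.Re (P1 n n)) - (fun n => complex.Re (P2 n n)).
  apply/funext => n; rewrite AE.
  have := positive_op_diag_Im n p3; have := positive_op_diag_Im n p4.
  rewrite !fctE; case: (P1 n n) (P2 n n) (P3 n n) (P4 n n).
  move=> a b [c d] [e f] [g h] /= -> ->; ring.
exact: is_cvg_seriesB.
Qed.

Lemma quantum_channel_state (R : realType) (E : op R -> op R) (rho : op R) :
  quantum_channel E -> state rho -> state (E rho).
Proof.
move=> chE [rho_ptc tr1]; have tc := positive_trace_class_trace_class rho_ptc.
split; last by rewrite (channel_trace_preserving chE).
apply: trace_class_positive; first exact: (channel_trace_class chE).
apply/positive_op_block.
apply: (channel_completely_positive chE (T := fun _ _ => rho)) => //.
by apply/positive_op_block; case: rho_ptc.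
Qed.

Lemma quantum_channel_comp (R : realType) (E1 E2 : op R -> op R) :
  quantum_channel E1 -> quantum_channel E2 -> quantum_channel (E2 \o E1).
Proof.
move=> ch1 ch2; split=> [T tcT | c S T tcS tcT | n T tcT posT | T tcT] /=.
- by apply: (channel_trace_class ch2); apply: (channel_trace_class ch1).
- rewrite (channel_linear ch1) // (channel_linear ch2) //;
  exact: (channel_trace_class ch1).
- apply: (channel_completely_positive ch2).
    by move=> i j; apply: (channel_trace_class ch1).
  exact: (channel_completely_positive ch1).
- rewrite (channel_trace_preserving ch2) ?(channel_trace_preserving ch1) //.
  exact: (channel_trace_class ch1).
Qed.

Lemma gaussian_channel_comp (R : realType) (X1 Y1 X2 Y2 : 'M[R]_2)
    (E1 E2 : op R -> op R) :
  gaussian_channel X1 Y1 E1 -> gaussian_channel X2 Y2 E2 ->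
  gaussian_channel (X2 *m X1) (X2 *m Y1 *m X2^T + Y2) (E2 \o E1).
Proof.
move=> [ch1 g1 s1 m1] [ch2 g2 s2 m2]; split.
- exact: quantum_channel_comp.
- by move=> rho /g1 /g2.
- by rewrite linearD /= !trmx_mul trmxK s1 s2 mulmxA.
- move=> rho st fin; have [f1 d1 V1] := m1 _ st fin.
  have [f2 d2 V2] := m2 _ (quantum_channel_state ch1 st) f1.
  split=> //=; first by rewrite d2 d1 mulmxA.
  (* X2 (X1 V X1^T + Y1) X2^T + Y2 is expanded and regrouped around X2 X1. *)
  by rewrite V2 V1 mulmxDr mulmxDl trmx_mul !mulmxA addrA.
Qed.

(** The new index n + 1 ends the interval, so reversal puts its factor leftmost. With m <= n the
    interval really grows. *)
Lemma descending_prodS (R : realType) (X : nat -> 'M[R]_2) (m n : nat) :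
  (m <= n)%N -> descending_prod X m n.+1 = X n.+1 *m descending_prod X m n.
Proof.
move=> le_mn; rewrite /descending_prod /index_iota subSS subSn // -(addn1 (n - m)) iotaD.
by rewrite rev_cat big_cat /= big_seq1 addSn subnKC.
Qed.

Lemma descending_prod_nn (R : realType) (X : nat -> 'M[R]_2) (n : nat) :
  descending_prod X n n = 1%:M.
Proof. by rewrite /descending_prod /index_iota subnn big_nil. Qed.

Lemma gaussian_channel_cascade (R : realType) (X Y : nat -> 'M[R]_2)
    (E : nat -> op R -> op R) (L : nat) : (1 <= L)%N ->
  (forall k, (1 <= k <= L)%N -> gaussian_channel (X k) (Y k) (E k)) ->
  gaussian_channel (descending_prod X 0 L)
    (\sum_(1 <= k < L.+1)
       descending_prod X k L *m Y k *m (descending_prod X k L)^T)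
    (cascade E L).
Proof.
(* The induction starts at a single segment, where the product to the left of [Y 1] is empty. *)
case: L => // L _; elim: L => [|L IH] gE.
  rewrite big_nat1 descending_prodS // !descending_prod_nn trmx1 !mulmx1 mul1mx.
  exact: gE.
have g1 : forall k, (1 <= k <= L.+1)%N -> gaussian_channel (X k) (Y k) (E k).
  by move=> k /andP[k1 kL]; apply: gE; rewrite k1 leqW.
have gL : gaussian_channel (X L.+2) (Y L.+2) (E L.+2).
  by apply: gE; rewrite leqnn.
have := gaussian_channel_comp (IH g1) gL.
(* Conjugation by the newest X is distributed over the accumulated noise, while the last term of the
   target sum is split off: its product is empty, so it is the newest Y alone. *)
rewrite -descending_prodS // mulmx_sumr mulmx_suml [in X in _ -> X]big_nat_recr //=.
rewrite descending_prod_nn trmx1 mulmx1 mul1mx.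
congr (gaussian_channel _ (_ + _) _).
apply: eq_big_nat => k /andP[_ kL].
(* For each earlier segment the newest X is absorbed as the leftmost factor of its product. *)
by rewrite (@descending_prodS _ _ _ L.+1) // trmx_mul !mulmxA.
Qed.

Lemma complex_mx1 (R : realType) : complex_mx (1 : R[i]) = 1%:M.
Proof.
by apply/matrixP=> i j; rewrite !mxE; case: eqP => // _; rewrite oppr0 if_same.
Qed.

Lemma complex_mxM (R : realType) (z w : R[i]) :
  complex_mx (z * w) = complex_mx z *m complex_mx w.
Proof.
case: z w => [a b] [c d]; apply/matrixP => i j.
rewrite !mxE !big_ord_recl big_ord0 !mxE.
by case: i j => [[|[|//]] ?] [[|[|//]] ?] /=; ring.
Qed.

(** Transposition corresponds to complex conjugation, and z times its conjugate is |z|^2. *)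
Lemma complex_mx_mul_tr (R : realType) (z : R[i]) :
  complex_mx z *m (complex_mx z)^T = (Normc.normc z ^+ 2)%:M.
Proof.
case: z => a b; apply/matrixP => i j.
rewrite !mxE !big_ord_recl big_ord0 !mxE /= sqr_sqrtr ?addr_ge0 ?sqr_ge0 //.
by case: i j => [[|[|//]] ?] [[|[|//]] ?] /=; rewrite ?mulr1n ?mulr0n; ring.
Qed.

Lemma descending_prod_complex_mx (R : realType) (mu : nat -> R[i]) (m n : nat) :
  descending_prod (fun k => complex_mx (mu k)) m n =
    complex_mx (\prod_(m.+1 <= j < n.+1) mu j).
Proof.
rewrite /descending_prod; elim: (index_iota _ _) => [|j s IH].
  by rewrite !big_nil complex_mx1.
(* Reversal sends the head factor to the right end; commutativity in [R[i]] makes this order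
   immaterial. *)
rewrite rev_cons -cats1 big_cat /= big_seq1 IH big_cons mulrC.
by rewrite complex_mxM.
Qed.

Lemma normc_prod (R : realType) (I : Type) (s : seq I) (f : I -> R[i]) :
  Normc.normc (\prod_(i <- s) f i) = \prod_(i <- s) Normc.normc (f i).
Proof.
apply: (big_morph (@Normc.normc R)); first exact: Normc.normcM.
by rewrite /= expr1n expr0n addr0 sqrtr1.
Qed.

(** P is the matrix of one complex number, the product of the [mu j]; the scalar y commutes out,
    leaving P P^T, and the modulus is multiplicative. *)
Lemma descending_prod_complex_mx_scalar (R : realType) (mu : nat -> R[i])
    (y : R) (m n : nat) :
  let P := descending_prod (fun k => complex_mx (mu k)) m n in
  P *m y%:M *m P^T =
    ((\prod_(m.+1 <= j < n.+1) Normc.normc (mu j) ^+ 2) * y)%:M.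
Proof.
rewrite /= descending_prod_complex_mx mul_mx_scalar -scalemxAl.
rewrite complex_mx_mul_tr normc_prod -prodrXl.
by rewrite scale_scalar_mx mulrC.
Qed.

Theorem mainTheorem2 (R : realType) :
  (forall (X1 Y1 X2 Y2 : 'M[R]_2) (E1 E2 : op R -> op R),
     gaussian_channel X1 Y1 E1 -> gaussian_channel X2 Y2 E2 ->
     gaussian_channel (X2 *m X1) (X2 *m Y1 *m X2^T + Y2) (E2 \o E1))
  /\
  (forall (hbar kB : R) (L : nat) (Omega dz Gamma Tm : R)
          (alpha : nat -> R) (G : nat -> R[i]) (OmegaB : nat -> R),
     0 < hbar -> 0 < kB -> (1 <= L)%N -> 0 < dz -> 0 < Gamma -> 0 < Tm ->
     (forall k, (1 <= k <= L)%N -> 0 <= alpha k) ->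
     (forall k, (1 <= k <= L)%N -> 0 < OmegaB k) ->
     let eta k : R := expR (- alpha k * dz) in
     let eta' k : R := 1 - eta k in
     let chi k : R[i] := 1 / ((Gamma / 2) +i* (Omega - OmegaB k)) in
     let kappa k : R[i] := (Normc.normc (G k) ^+ 2)%:C * chi k * dz%:C in
     let mu k : R[i] := (Num.sqrt (eta k))%:C + kappa k in
     let nu k : R[i] :=
       - (0 +i* 1) * G k * (Num.sqrt Gamma)%:C * chi k * dz%:C in
     let nbar k : R := 1 / (expR (hbar * OmegaB k / (kB * Tm)) - 1) in
     let X k : 'M[R]_2 := complex_mx (mu k) in
     let Y k : 'M[R]_2 :=
       ((nbar k + 1 / 2) * Normc.normc (nu k) ^+ 2 + eta' k / 2)%:M in
     let Xtot : 'M[R]_2 := descending_prod X 0 L in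
     let Ytot : 'M[R]_2 :=
       \sum_(1 <= k < L.+1)
          descending_prod X k L *m Y k *m (descending_prod X k L)^T in
     let mutot : R[i] := \prod_(1 <= k < L.+1) mu k in
     let ytot : R :=
       \sum_(1 <= k < L.+1)
          (\prod_(k.+1 <= j < L.+1) Normc.normc (mu j) ^+ 2)
          * (eta' k / 2
             + (nbar k + 1 / 2) * Normc.normc (nu k) ^+ 2) in
     [/\ forall E : nat -> op R -> op R,
           (forall k, (1 <= k <= L)%N -> gaussian_channel (X k) (Y k) (E k)) ->
           gaussian_channel Xtot Ytot (cascade E L),
         Xtot = complex_mx mutot &
         Ytot = ytot%:M]).
Proof.
split; first exact: gaussian_channel_comp.
move=> hbar kB L Omega dz Gamma Tm alpha G OmegaB _ _ L_gt0 _ _ _ _ _.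
move=> eta eta' chi kappa mu nu nbar X Y Xtot Ytot mutot ytot; split.
- by move=> E; apply: gaussian_channel_cascade.
- exact: descending_prod_complex_mx.
(* Scalar matrices add like their scalars, so the sums are compared term by term; only the order of
   thermal and vacuum noise differs. *)
- rewrite /Ytot /ytot raddf_sum; apply: eq_bigr => k _.
  by rewrite descending_prod_complex_mx_scalar addrC.
Qed.
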